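(* Let $(A,\cdot,D,Q)$ be an admissible commutative differential algebra, $q\in\mathbf{k}$, and $(A,\circ_q)$ the Novikov algebra induced from $(A,\cdot,D,Q)$, $a\circ_q b=a\cdot(D+qQ)(b)$. Let $T:V\to A$ be an $\mathcal{O}$-operator on $(A,\cdot,D,Q)$ associated to a representation $(V,l_A,\alpha,\beta)$ of $(A,\cdot,D,Q)$. Then $T$ is an $\mathcal{O}$-operator on $(A,\circ_q)$ associated to $(V,l_{l_A,q},r_{l_A,q})$, where $$l_{l_A,q}(a)v:=l_A(a)(\alpha+q\beta)(v),\qquad r_{l_A,q}(a)v:=l_A((D+qQ)(a))v,\qquad a\in A,\ v\in V.$$
   Context: $\mathbf{k}$ is a field of characteristic $0$; all vector spaces are over $\mathbf{k}$ and finite-dimensional. Admissible commutative differential algebra $(A,\cdot,D,Q)$: $(A,\cdot)$ commutative associative, $D,Q:A\to A$ linear, $D(a\cdot b)=D(a)\cdot b+a\cdot D(b)$, $Q(a\cdot b)=Q(a)\cdot b-a\cdot D(b)$. Then $\circ_q$ is a Novikov product, i.e. $(a\circ b)\circ c-a\circ(b\circ c)=(b\circ a)\circ c-b\circ(a\circ c)$ and $(a\circ b)\circ c=(a\circ c)\circ b$. A representation $(V,l_A,\alpha,\beta)$ of $(A,\cdot,D,Q)$: $l_A:A\to\mathrm{End}_{\mathbf{k}}(V)$ linear with $l_A(a\cdot b)=l_A(a)l_A(b)$, and linear maps $\alpha,\beta:V\to V$ with $\alpha(l_A(a)v)=l_A(D(a))v+l_A(a)\alpha(v)$ and $\beta(l_A(a)v)=l_A(a)\beta(v)-l_A(D(a))v=l_A(Q(a))v-l_A(a)\alpha(v)$.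 An $\mathcal{O}$-operator on $(A,\cdot,D,Q)$ associated to $(V,l_A,\alpha,\beta)$ is a linear map $T:V\to A$ with $DT=T\alpha$, $QT=T\beta$ and $T(u)\cdot T(v)=T(l_A(T(u))v+l_A(T(v))u)$ for all $u,v\in V$. A representation $(V,l,r)$ of a Novikov algebra $(A,\circ)$: linear maps $l,r:A\to\mathrm{End}_{\mathbf{k}}(V)$ with $l(a\circ b-b\circ a)=l(a)l(b)-l(b)l(a)$, $l(a)r(b)-r(b)l(a)=r(a\circ b)-r(b)r(a)$, $l(a\circ b)=r(b)l(a)$, $r(a)r(b)=r(b)r(a)$. An $\mathcal{O}$-operator on $(A,\circ)$ associated to $(V,l,r)$ is a linear map $T:V\to A$ with $T(u)\circ T(v)=T(l(T(u))v)+T(r(T(v))u)$ for all $u,v\in V$. It is known that $(V,l_{l_A,q},r_{l_A,q})$ is a representation of $(A,\circ_q)$. *)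

(* Defs.v *)
From HB Require Import structures.
From mathcomp Require Import all_boot all_order all_algebra.
Set Implicit Arguments.
Unset Strict Implicit.
Unset Printing Implicit Defensive.
Import GRing.Theory.
Local Open Scope ring_scope.

(* A bilinear product on A is encoded by its left multiplications, that is, by
   a linear map A -> 'End(A); no unit is assumed. *)

Record admCDA (k : fieldType) (A : vectType k) := AdmCDA {
  cda_mul : {linear A -> 'End(A)};
  cda_D : 'End(A);
  cda_Q : 'End(A);
  cda_mulC : forall a b, cda_mul a b = cda_mul b a;
  cda_mulA : forall a b c, cda_mul (cda_mul a b) c = cda_mul a (cda_mul b c);
  cda_DM : forall a b,
    cda_D (cda_mul a b) = cda_mul (cda_D a) b + cda_mul a (cda_D b);
  cda_QM : forall a b,
    cda_Q (cda_mul a b) = cda_mul (cda_Q a) b - cda_mul a (cda_D b)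
}.

Record cda_rep (k : fieldType) (A : vectType k) (S : admCDA A)
    (V : vectType k) := CdaRep {
  crep_l : {linear A -> 'End(V)};
  crep_alpha : 'End(V);
  crep_beta : 'End(V);
  crep_lM : forall a b, crep_l (cda_mul S a b) = (crep_l a \o crep_l b)%VF;
  crep_alphaM : forall a v,
    crep_alpha (crep_l a v) = crep_l (cda_D S a) v + crep_l a (crep_alpha v);
  crep_betaMD : forall a v,
    crep_beta (crep_l a v) = crep_l a (crep_beta v) - crep_l (cda_D S a) v;
  crep_betaMQ : forall a v,
    crep_beta (crep_l a v) = crep_l (cda_Q S a) v - crep_l a (crep_alpha v)
}.

Record cda_Ooperator (k : fieldType) (A V : vectType k) (S : admCDA A)
    (M : cda_rep S V) (T : 'Hom(V, A)) : Prop := CdaOoperator {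
  cdaO_D : (cda_D S \o T)%VF = (T \o crep_alpha M)%VF;
  cdaO_Q : (cda_Q S \o T)%VF = (T \o crep_beta M)%VF;
  cdaO_M : forall u v,
    cda_mul S (T u) (T v) = T (crep_l M (T u) v + crep_l M (T v) u)
}.

Record novikov (k : fieldType) (A : vectType k) := Novikov {
  nov_mul : {linear A -> 'End(A)};
  nov_lsym : forall a b c,
    nov_mul (nov_mul a b) c - nov_mul a (nov_mul b c)
    = nov_mul (nov_mul b a) c - nov_mul b (nov_mul a c);
  nov_rcomm : forall a b c,
    nov_mul (nov_mul a b) c = nov_mul (nov_mul a c) b
}.

Record novikov_rep (k : fieldType) (A : vectType k) (N : novikov A)
    (V : vectType k) := NovikovRep {
  nrep_l : {linear A -> 'End(V)};
  nrep_r : {linear A -> 'End(V)};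
  nrep_lB : forall a b,
    nrep_l (nov_mul N a b - nov_mul N b a)
    = (nrep_l a \o nrep_l b)%VF - (nrep_l b \o nrep_l a)%VF;
  nrep_lr : forall a b,
    (nrep_l a \o nrep_r b)%VF - (nrep_r b \o nrep_l a)%VF
    = nrep_r (nov_mul N a b) - (nrep_r b \o nrep_r a)%VF;
  nrep_lM : forall a b, nrep_l (nov_mul N a b) = (nrep_r b \o nrep_l a)%VF;
  nrep_rC : forall a b,
    (nrep_r a \o nrep_r b)%VF = (nrep_r b \o nrep_r a)%VF
}.

Definition novikov_Ooperator (k : fieldType) (A V : vectType k)
    (N : novikov A) (M : novikov_rep N V) (T : 'Hom(V, A)) : Prop :=
  forall u v,
    nov_mul N (T u) (T v) = T (nrep_l M (T u) v) + T (nrep_r M (T v) u).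

Section InducedNovikov.
Variables (k : fieldType) (A : vectType k) (S : admCDA A) (q : k).

Definition cda_DqQ : 'End(A) := cda_D S + q *: cda_Q S.

Definition circ_q (a : A) : 'End(A) := (cda_mul S a \o cda_DqQ)%VF.

Lemma circ_q_linear : linear circ_q.
Proof.
by move=> c a b; rewrite /circ_q linearP comp_lfunDl comp_lfunZl.
Qed.
HB.instance Definition _ := GRing.isLinear.Build k A 'End(A) _ circ_q
  circ_q_linear.

Lemma circ_qE a b : circ_q a b = cda_mul S a (cda_DqQ b).
Proof. by rewrite /circ_q comp_lfunE. Qed.

Lemma cda_DqQE a : cda_DqQ a = cda_D S a + q *: cda_Q S a.
Proof. by rewrite /cda_DqQ add_lfunE scale_lfunE. Qed.

Lemma cda_DqQM a b :
  cda_DqQ (cda_mul S a b)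
  = cda_mul S (cda_DqQ a) b + (1 - q) *: cda_mul S a (cda_D S b).
Proof.
rewrite !cda_DqQE cda_DM cda_QM [cda_mul S (_ + _)]linearD.
rewrite [cda_mul S (q *: _)]linearZ /= add_lfunE scale_lfunE.
by rewrite scalerBr scalerBl scale1r addrACA.
Qed.

Lemma circ_qB a b :
  circ_q a b - circ_q b a
  = (1 - q) *: (cda_mul S a (cda_D S b) - cda_mul S b (cda_D S a)).
Proof.
have E : cda_mul S a (cda_Q S b) - cda_mul S b (cda_Q S a)
         = - (cda_mul S a (cda_D S b) - cda_mul S b (cda_D S a)).
  have H := cda_QM S b a; rewrite (cda_mulC S b a) cda_QM in H.
  rewrite (cda_mulC S a) (cda_mulC S b (cda_Q S a)).
  rewrite -[cda_mul S (cda_Q S b) a](subrK (cda_mul S b (cda_D S a))) -H.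
  by rewrite opprB [LHS]addrC !addrA addNr add0r addrC.
rewrite !circ_qE !cda_DqQE !(linearD (cda_mul S _)) !linearZ /= opprD addrACA.
rewrite -scalerBr E.
by rewrite scalerN scalerBl scale1r.
Qed.

Lemma circ_qA a b c :
  circ_q (circ_q a b) c - circ_q a (circ_q b c)
  = - ((1 - q) *: cda_mul S (cda_mul S a b) (cda_D S (cda_DqQ c))).
Proof.
rewrite !circ_qE cda_DqQM linearD linearZ /= !cda_mulA ?opprD addrA.
by rewrite subrr add0r.
Qed.

Lemma circ_q_lsym a b c :
  circ_q (circ_q a b) c - circ_q a (circ_q b c)
  = circ_q (circ_q b a) c - circ_q b (circ_q a c).
Proof. by rewrite !circ_qA (cda_mulC S a b). Qed.

Lemma circ_q_rcomm a b c : circ_q (circ_q a b) c = circ_q (circ_q a c) b.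
Proof.
by rewrite !circ_qE !cda_mulA (cda_mulC S (cda_DqQ b)).
Qed.

Definition induced_novikov : novikov A := Novikov circ_q_lsym circ_q_rcomm.

Variables (V : vectType k) (M : cda_rep S V).

Definition crep_gamma : 'End(V) := crep_alpha M + q *: crep_beta M.

Definition lq (a : A) : 'End(V) := (crep_l M a \o crep_gamma)%VF.

Definition rq (a : A) : 'End(V) := crep_l M (cda_DqQ a).

Lemma lq_linear : linear lq.
Proof. by move=> c a b; rewrite /lq linearP comp_lfunDl comp_lfunZl. Qed.
HB.instance Definition _ := GRing.isLinear.Build k A 'End(V) _ lq lq_linear.

Lemma rq_linear : linear rq.
Proof. by move=> c a b; rewrite /rq !linearP. Qed.
HB.instance Definition _ := GRing.isLinear.Build k A 'End(V) _ rq rq_linear.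

Lemma crep_gammaE v : crep_gamma v = crep_alpha M v + q *: crep_beta M v.
Proof. by rewrite /crep_gamma add_lfunE scale_lfunE. Qed.

Lemma crep_lME a b v :
  crep_l M (cda_mul S a b) v = crep_l M a (crep_l M b v).
Proof. by rewrite crep_lM comp_lfunE. Qed.

Lemma crep_lC a b v :
  crep_l M a (crep_l M b v) = crep_l M b (crep_l M a v).
Proof. by rewrite -!crep_lME cda_mulC. Qed.

Lemma lqE a v : lq a v = crep_l M a (crep_gamma v).
Proof. by rewrite /lq comp_lfunE. Qed.

Lemma crep_gammaM a v :
  crep_gamma (crep_l M a v)
  = crep_l M a (crep_gamma v) + (1 - q) *: crep_l M (cda_D S a) v.
Proof.
rewrite !crep_gammaE crep_alphaM crep_betaMD (linearD (crep_l M a)) linearZ /=.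
by rewrite scalerBr scalerBl scale1r (addrC (crep_l M (cda_D S a) v)) addrACA.
Qed.

Lemma lqB a b :
  lq (circ_q a b - circ_q b a) = (lq a \o lq b)%VF - (lq b \o lq a)%VF.
Proof.
apply/lfunP => v; rewrite circ_qB add_lfunE opp_lfunE (comp_lfunE (lq a)).
rewrite (comp_lfunE (lq b)) !lqE !crep_gammaM.
rewrite !(linearD (crep_l M _)) !linearZ /= (crep_lC b a) opprD addrACA.
rewrite subrr add0r -scalerBr scale_lfunE linearB add_lfunE opp_lfunE.
by rewrite !crep_lME.
Qed.

Lemma lq_rq a b :
  (lq a \o rq b)%VF - (rq b \o lq a)%VF
  = rq (circ_q a b) - (rq b \o rq a)%VF.
Proof.
apply/lfunP => v; rewrite !add_lfunE !opp_lfunE (comp_lfunE (lq a)).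
rewrite !(comp_lfunE (rq b)) !lqE /rq circ_qE.
rewrite crep_gammaM cda_DqQM (linearD (crep_l M a)) (linearD (crep_l M)).
move: (cda_DqQ a) (cda_DqQ b) (crep_gamma v) => a' b' w.
rewrite !linearZ /= add_lfunE scale_lfunE !crep_lME.
rewrite (crep_lC a b') (crep_lC a' b').
by rewrite addrAC subrr add0r addrAC subrr add0r.
Qed.

Lemma lqM a b : lq (circ_q a b) = (rq b \o lq a)%VF.
Proof.
by apply/lfunP => v; rewrite (comp_lfunE (rq b)) !lqE /rq circ_qE crep_lME
  crep_lC.
Qed.

Lemma rqC a b : (rq a \o rq b)%VF = (rq b \o rq a)%VF.
Proof. by apply/lfunP => v; rewrite !comp_lfunE /rq crep_lC. Qed.

Definition induced_rep : novikov_rep induced_novikov V :=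
  @NovikovRep _ _ induced_novikov _ lq rq lqB lq_rq lqM rqC.

End InducedNovikov.

(* Main.v *)
Require Import Defs.
From mathcomp Require Import all_boot all_order all_algebra.
Local Open Scope ring_scope.

(** Since [T] is linear and intertwines alpha with D and beta with Q, it intertwines alpha + q beta
    with D + qQ. The Novikov identity at (u, v) is then the commutative one at (u, (alpha + q beta)
    v). *)

Lemma cda_Ooperator_DqQ (k : fieldType) (A V : vectType k) (S : admCDA A)
    (q : k) (M : cda_rep S V) (T : 'Hom(V, A)) (v : V) :
  cda_Ooperator M T -> cda_DqQ S q (T v) = T (crep_gamma q M v).
Proof.
case=> TD TQ _; rewrite cda_DqQE crep_gammaE GRing.linearD GRing.linearZ /=.
by rewrite -!comp_lfunE TD TQ.
Qed.

Theorem proposition3p23 (k : fieldType) (char0 : [pchar k] =i pred0)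
    (A V : vectType k) (S : admCDA A) (q : k) (M : cda_rep S V)
    (T : 'Hom(V, A)) :
  cda_Ooperator M T -> novikov_Ooperator (induced_rep q M) T.
Proof.
(* Both occurrences of (D + qQ)(T v), in the product and in [rq], become [T (crep_gamma q M v)],
   which gives [cdaO_M] its shape. *)
move=> TO u v; rewrite /= circ_qE lqE /rq (cda_Ooperator_DqQ _ _ _ _ _ _ _ _ TO).
by rewrite (cdaO_M TO) GRing.linearD.
Qed.
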